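(* Let $\Omega$ be an infinite set and let $\alpha,\beta$ be cardinals. The set $S_{\alpha,\beta}(\Omega)$ is generating for the group $S(\Omega)$ if and only if at least one of the cardinals $\alpha,\beta$ is equal to $|\Omega|$.
   Context: $S(\Omega)$ is the group of all bijections $\Omega\to\Omega$. For $f\in S(\Omega)$, a subset $U\subset\Omega$ is an $f$-eigenspace if $f(x)\in U$ for all $x\in U$, and $M_f=\{x\in\Omega\mid f(x)\neq x\}$ is the set of non-fixed elements of $f$. For cardinals $\alpha,\beta$, $S_{\alpha,\beta}(\Omega)$ is the set of all $f\in S(\Omega)$ such that $M_f$ is a disjoint union of $\alpha$ $f$-eigenspaces, each of cardinality equal to $\beta$. A subset is generating for $S(\Omega)$ if the smallest subgroup containing it is $S(\Omega)$.
   Formalization: The claim fails in degenerate cases (e.g. α=|Ω|, β=1, where the set is empty), so it is assumed that if α=|Ω| then 2≤β≤|Ω|, and if β=|Ω| then 1≤α≤|Ω|; in every excluded case the equivalence is false. *)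

(* Defs.v *)
From HB Require Import structures.
From mathcomp Require Import all_boot.
From mathcomp Require Import all_classical.

Set Implicit Arguments.
Unset Strict Implicit.
Unset Printing Implicit Defensive.

Local Open Scope classical_set_scope.
Local Open Scope card_scope.

Record symg (T : Type) := Symg {
  symg_fun :> T -> T;
  symg_bij : bijective symg_fun
}.

HB.instance Definition _ (T : Type) := gen_eqMixin (symg T).
HB.instance Definition _ (T : Type) := gen_choiceMixin (symg T).

Section SymmetricGroup.
Variable T : Type.
Implicit Types f g h : symg T.

Lemma symg_ext f g : f =1 g -> f = g.
Proof.
case: f g => [f fbij] [g gbij] /= /funext fg; move: fbij gbij; rewrite fg.
by move=> fbij gbij; rewrite (Prop_irrelevance fbij gbij).
Qed.

Lemma symg_inv_ex f : exists g : symg T, cancel f g /\ cancel g f.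
Proof.
by case: f => f /= fbij; case: (fbij) => g fK gK; exists (Symg (Bijective gK fK)).
Qed.

Definition symg_one : symg T := Symg (Bijective (frefl id) (frefl id)).
Definition symg_mul f g : symg T := Symg (bij_comp (symg_bij f) (symg_bij g)).
Definition symg_inv f : symg T := sval (cid (symg_inv_ex f)).

Lemma symg_mulA : associative symg_mul.
Proof. by move=> f g h; apply: symg_ext. Qed.

Lemma symg_1mul : left_id symg_one symg_mul.
Proof. by move=> f; apply: symg_ext. Qed.

Lemma symg_mul1 : right_id symg_one symg_mul.
Proof. by move=> f; apply: symg_ext. Qed.

Lemma symg_Vmul : left_inverse symg_one symg_inv symg_mul.
Proof.
by move=> f; apply: symg_ext => x /=; rewrite /symg_inv; case: cid => g [] /=.
Qed.

Lemma symg_mulV : right_inverse symg_one symg_inv symg_mul.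
Proof.
by move=> f; apply: symg_ext => x /=; rewrite /symg_inv; case: cid => g [] /=.
Qed.

End SymmetricGroup.

HB.instance Definition _ (T : Type) :=
  isGroup.Build (symg T) (@symg_mulA T) (@symg_1mul T) (@symg_mul1 T)
    (@symg_Vmul T) (@symg_mulV T).

Definition subgroup (G : groupType) (H : set G) : Prop :=
  group_closed [in H].

Definition generating (G : groupType) (X : set G) : Prop :=
  smallest (@subgroup G) X = [set: G].

Definition f_eigenspace (T : Type) (f : symg T) (U : set T) : Prop :=
  forall x, U x -> U (f x).

Definition nonfixed (T : Type) (f : symg T) : set T := [set x | f x <> x].

(* A cardinal is given by a type of that cardinality: [alpha] and [beta] stand
   for the cardinals |alpha| and |beta|. *)
Definition S_card (alpha beta T : Type) : set (symg T) :=
  [set f | exists F : alpha -> set T,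
    [/\ nonfixed f = \bigcup_i F i,
        trivIset [set: alpha] F,
        forall i, f_eigenspace f (F i) &
        forall i, F i #= [set: beta]]].
Arguments S_card : clear implicits.

(* Main.v *)
Require Import Defs.
From mathcomp Require Import all_boot.
From mathcomp Require Import all_classical.

(* Each generator moves at most |alpha| * |beta| points. If neither cardinal is
   |Omega|, this is less than |Omega|, and the permutations moving fewer than
   |Omega| points form a proper subgroup.

   Conversely, the generated subgroup N is normal and contains a fixed-point
   free f. Choose A of cardinality |Omega| with A and f A disjoint. For h and s
   supported in A, [[h, f], s] = [h, s], and taking for s a shift of slices of A
   indexed by the integers shows that N contains every permutation of a slice.
   By conjugation N contains every permutation fixing |Omega| points, and every
   permutation is a product of two of those. *)

Set Implicit Arguments.
Unset Strict Implicit.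
Unset Printing Implicit Defensive.

Local Open Scope classical_set_scope.
Local Open Scope card_scope.

(** * Comparison of cardinals by injections *)

Lemma card_leTP T U (A : set U) :
  [set: T] #<= A <-> exists2 f : T -> U, injective f & forall x, A (f x).
Proof.
split=> [/card_leP[f]|[f finj fA]].
  exists (fun x => set_val (f (SigSub (mem_set (I : [set: T] x))))).
    move=> x y /val_inj/inj.
    by rewrite !inE => /(_ I I) [].
  by move=> x; apply: set_valP.
rewrite -(card_le_eql (inj_card_eq (in2W finj))).
by apply: subset_card_le => _ [x _ <-].
Qed.

Lemma card_leTTP T U :
  [set: T] #<= [set: U] <-> exists f : T -> U, injective f.
Proof.
split=> [/card_leTP[f fi _]|[f fi]]; first by exists f.
by apply/card_leTP; exists f.
Qed.

Lemma injective_pair T U T' U' (f : T -> U) (g : T' -> U') :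
  injective f -> injective g -> injective (fun p => (f p.1, g p.2)).
Proof. by move=> fi gi [a b] [c d] [/fi -> /gi ->]. Qed.

(** Zorn's lemma gives a maximal graph of a partial injection from [T] to [U]. If it missed both
    some [x] and some [y], the pair [(x, y)] could be added; so it is total on one side and yields
    an injection from that side. *)
Lemma card_le_total T U :
  [set: T] #<= [set: U] \/ [set: U] #<= [set: T].
Proof.
pose P := [set G : set (T * U) |
  forall p q, G p -> G q -> p.1 = q.1 <-> p.2 = q.2].
have [F FP Ftot|G [PG Gmax]] := @Zorn_bigcup _ P.
  move=> p q [X FX Xp] [Y FY Yq].
  have [XY|YX] := Ftot _ _ FX FY.
  - exact: (FP _ FY) (XY _ Xp) Yq.
  - exact: (FP _ FX) Xp (YX _ Yq).
have [Gl|/existsNP[x Gx]] := pselect (forall x, exists y, G (x, y)).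
  left; apply/card_leTTP; have [f fG] := choice Gl.
  by exists f => x y fxy; exact/(PG _ _ (fG x) (fG y)).
have [Gr|/existsNP[y Gy]] := pselect (forall y, exists x, G (x, y)).
  right; apply/card_leTTP; have [f fG] := choice Gr.
  by exists f => u v fuv; exact/(PG _ _ (fG u) (fG v)).
exfalso; apply: (Gmax ((x, y) |` G)).
  split; first by move=> p Gp; right.
  by move=> /(_ _ (or_introl erefl)) Gxy; apply: Gx; exists y.
move=> [a b] [c d] [[-> ->]|Gab] [[-> ->]|Gcd] //=.
- by split=> e; exfalso; [apply: Gx; exists d|apply: Gy; exists c]; rewrite e.
- by split=> e; exfalso; [apply: Gx; exists b|apply: Gy; exists a]; rewrite -e.
- exact: (PG _ _ Gab Gcd).
Qed.

Lemma card_mul_bool_of_square T :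
  [set: bool] #<= [set: T] -> [set: T * T] #<= [set: T] ->
  [set: T * bool] #<= [set: T].
Proof.
move=> /card_leTTP[b bi]; apply: card_le_trans; apply/card_leTTP.
by exists (fun p => (p.1, b p.2)); apply: (injective_pair (f := id)).
Qed.

(** * The square of an infinite set has the cardinality of the set *)

Section Square.
Variable T : Type.
Implicit Types (G : set ((T * T) * T)) (x y z : T).

(** Reading the set off the diagonal lets a single graph carry both the set and the injection, so
    that Zorn's lemma applies to plain inclusion of graphs. *)
Definition diag_dom G := [set x | exists z, G ((x, x), z)].

(* [G] is the graph of an injection from [A * A] to [A], where [A] is
   [diag_dom G]. *)
Definition square_inj G :=
  [/\ forall p q, G p -> G q -> p.1 = q.1 <-> p.2 = q.2,
      forall x y, diag_dom G x -> diag_dom G y -> exists z, G ((x, y), z) &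
      forall x y z, G ((x, y), z) ->
        [/\ diag_dom G x, diag_dom G y & diag_dom G z]].

Lemma square_inj_bigcup (F : set (set ((T * T) * T))) :
  total_on F subset -> F `<=` square_inj -> square_inj (\bigcup_(X in F) X).
Proof.
move=> Ftot FP.
have dF X x : F X -> diag_dom X x -> diag_dom (\bigcup_(X in F) X) x.
  by move=> FX [z Xz]; exists z; exists X.
split.
- move=> p q [X FX Xp] [Y FY Yq].
  have [XY|YX] := Ftot _ _ FX FY.
  + by have [h _ _] := FP _ FY; exact: h (XY _ Xp) Yq.
  + by have [h _ _] := FP _ FX; exact: h Xp (YX _ Yq).
- move=> x y [z [X FX Xz]] [t [Y FY Yt]].
  have [XY|YX] := Ftot _ _ FX FY.
  + have [_ h _] := FP _ FY.
    have [||u Yu] := h x y; [by exists z; apply: XY|by exists t|].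
    by exists u; exists Y.
  + have [_ h _] := FP _ FX.
    have [||u Xu] := h x y; [by exists z|by exists t; apply: YX|].
    by exists u; exists X.
- move=> x y z [X FX Xxyz]; have [_ _ /(_ _ _ _ Xxyz)[? ? ?]] := FP _ FX.
  by split; apply: (dF X).
Qed.

(** Supplies the starting graph for Zorn's lemma, by transporting a pairing on [X] along [i]. *)
Lemma square_inj_graph X (i : X -> T) (s : X * X -> X) :
  injective i -> injective s ->
  square_inj [set p | exists u v, p = ((i u, i v), i (s (u, v)))] /\
  forall u, diag_dom [set p | exists u v, p = ((i u, i v), i (s (u, v)))] (i u).
Proof.
move=> ii si.
set G := [set p | _].
have dG u : diag_dom G (i u) by exists (i (s (u, u))), u, u.
split=> //; split.
- move=> _ _ [u [v ->]] [u' [v' ->]] /=; split.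
    by move=> [/ii -> /ii ->].
  by move=> /ii/si[-> ->].
- move=> x y [z [u [v [-> _ _]]]] [z' [u' [v' [-> _ _]]]].
  by exists (i (s (u, u'))), u, u'.
- by move=> x y z [u [v [-> -> ->]]]; split.
Qed.

Lemma square_inj_embed G : square_inj G ->
  [set: diag_dom G * diag_dom G] #<= [set: diag_dom G].
Proof.
move=> [Ginj Gtot Gcl]; apply/card_leTTP.
have : forall p : diag_dom G * diag_dom G, exists z : diag_dom G,
  G ((set_val p.1, set_val p.2), set_val z).
  move=> p; have [z Gz] := Gtot _ _ (set_valP p.1) (set_valP p.2).
  have [_ _ dz] := Gcl _ _ _ Gz.
  by exists (SigSub (mem_set dz)).
move=> /choice[f fG]; exists f => -[a b] [c d] e.
have := fG (a, b); have := fG (c, d); rewrite -e /= => h1 h2.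
by have [/(_ erefl) [/val_inj -> /val_inj ->] _] :=
  iff_sym (Ginj _ _ h2 h1).
Qed.

(* If the complement of [A] is at least as big as [A], pairs not in [A * A] of
   elements of [A + j A] can be coded injectively by elements of [j A]. *)
Lemma square_inj_extend G : square_inj G ->
  [set: bool] #<= [set: diag_dom G] ->
  [set: diag_dom G] #<= ~` diag_dom G ->
  exists2 H, square_inj H & G `<` H.
Proof.
move=> PG b2 /card_leTP[j ji jG].
have sq := square_inj_embed PG.
have /card_leTTP[s si] := sq.
have /card_leTTP[d di] := card_mul_bool_of_square b2 sq.
pose h (p : (diag_dom G * bool) * (diag_dom G * bool)) := s (d p.1, d p.2).
have hi : injective h by move=> p q /si /(injective_pair di di).
(* [e] identifies two copies of A with A and [j A], and [h] codes pairs from the two copies in one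
   A; [j] then moves the code out of A. *)
pose e (u : diag_dom G * bool) := if u.2 then j u.1 else set_val u.1.
have ei : injective e.
  move=> [a []] [b []] /=; rewrite /e /=.
  - by move=> /ji ->.
  - by move=> ab; have := jG a; rewrite ab; case; exact: set_valP.
  - by move=> ab; have := jG b; rewrite -ab; case; exact: set_valP.
  - by move=> /val_inj ->.
pose N := [set p : (T * T) * T |
  exists u v, [/\ u.2 || v.2 & p = ((e u, e v), j (h (u, v)))]].
have dj a : diag_dom (G `|` N) (j a).
  exists (j (h ((a, true), (a, true)))); right.
  by exists (a, true), (a, true).
have dG x : diag_dom G x -> diag_dom (G `|` N) x.
  by move=> [z Gz]; exists z; left.
have de u : diag_dom (G `|` N) (e u).
  by case: u => a [] /=; [exact: dj|apply: dG; exact: set_valP].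
have ed x : diag_dom (G `|` N) x -> exists u, x = e u.
  move=> [z [Gz|[u [v [_ [-> _ _]]]]]]; last by exists u.
  have dx : diag_dom G x by exists z.
  by exists (SigSub (mem_set dx), false).
have [Ginj Gtot Gcl] := PG.
have GN p q : G p -> N q -> p.1 <> q.1 /\ p.2 <> q.2.
  case: p => [[x y] z] Gp [u [v [uv ->]]] /=.
  have [dx dy dz] := Gcl _ _ _ Gp; split=> E.
    have [E1 E2] := E; subst x y.
    case: u v uv {E} dx dy {Gp} => [a []] [b []] //= _ dx dy.
    - exact: jG dx.
    - exact: jG dx.
    - exact: jG dy.
  by rewrite E in dz; apply: jG dz.
exists (G `|` N).
  split.
  - move=> p q [Gp|Np] [Gq|Nq].
    + exact: Ginj.
    + by have [? ?] := GN _ _ Gp Nq; split.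
    + by have [? ?] := GN _ _ Gq Np; split=> /esym.
    + have [u [v [_ ->]]] := Np; have [u' [v' [_ ->]]] := Nq => /=.
      split; first by move=> [/ei -> /ei ->].
      by move=> /ji/hi[-> ->].
  - move=> x y /ed[u ->] /ed[v ->].
    have [uv|] := boolP (u.2 || v.2).
      by exists (j (h (u, v))); right; exists u, v.
    rewrite negb_or; case: u v => [a []] [b []] //= _.
    have [z Gz] := Gtot _ _ (set_valP a) (set_valP b).
    by exists z; left.
  - move=> x y z [/Gcl[? ? ?]|[u [v [_ [-> -> ->]]]]]; first by split; apply: dG.
    by split; [exact: de|exact: de|exact: dj].
split; first by move=> p; left.
have /card_leTTP[b _] := b2.
pose u := (b true, true).
move=> /(_ ((e u, e u), j (h (u, u)))) NG.
apply: (jG (b true)); exists (j (h (u, u))); apply: NG.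
by right; exists u, u.
Qed.

End Square.

(** A maximal graph lives on a set A that cannot embed in its complement, since otherwise the graph
    would extend. So the complement embeds in A, [T] embeds in two copies of A and hence in A, and
    the pairing on A transfers to [T]. *)
Lemma card_square T : infinite_set [set: T] -> [set: T * T] #<= [set: T].
Proof.
move=> /infiniteP/card_leTTP[i ii].
have [dI PI] := square_inj_graph ii (pcan_inj (@pickleK (nat * nat)%type)).
set G0 := [set p | _] in dI PI.
(* The alternative [G = set0] covers the union of the empty chain; maximality excludes it
   afterwards. Containing [G0] makes A infinite. *)
have [F FP Ftot|G [[PG G0G] Gmax]] := @Zorn_bigcup _
  [set G | square_inj G /\ (G = set0 \/ G0 `<=` G)].
  split; first by apply: square_inj_bigcup => // X /FP[].
  have [[X [FX G0X]]|nX] := pselect (exists X, F X /\ G0 `<=` X).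
    by right; apply: subset_trans G0X _ => p Xp; exists X.
  left; apply: bigcup0 => X FX; have [_ []//] := FP _ FX.
  by move=> G0X; case: nX; exists X.
have {}G0G : G0 `<=` G.
  case: G0G => // G_0; exfalso; apply: (Gmax G0); last by split; [|right].
  rewrite G_0; split=> [//|] /(_ ((i 0, i 0), i (pickle (0, 0)))).
  by apply; exists 0, 0.
have dGi n : diag_dom G (i n).
  by have [z Gz] := PI n; exists z; apply: G0G.
have b2 : [set: bool] #<= [set: diag_dom G].
  apply/card_leTTP; exists (fun b : bool => SigSub (mem_set (dGi (nat_of_bool b)))).
  by move=> [] [] // [/ii].
have sq := square_inj_embed PG.
have [|DG] := card_le_total (diag_dom G) (~` diag_dom G).
  rewrite (card_le_eqr (card_setT (~` diag_dom G))) => AD.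
  have [H PH GH] := square_inj_extend PG b2 AD.
  exfalso; apply: (Gmax H) => //; split=> //; right.
  by apply: subset_trans G0G _; exact: properW.
suff TA : [set: T] #<= [set: diag_dom G].
  have /card_leTTP[f fi] := TA.
  have: [set: diag_dom G] #<= [set: T].
    by apply/card_leTTP; exists set_val; exact: val_inj.
  apply: card_le_trans; apply: card_le_trans sq.
  by apply/card_leTTP; exists (fun p => (f p.1, f p.2)); apply: injective_pair.
apply: card_le_trans (card_mul_bool_of_square b2 sq).
have /card_leTTP[j ji] := DG.
apply/card_leTTP.
pose f x := match pselect (diag_dom G x) with
  | left dx => (SigSub (mem_set dx), true)
  | right dx => (j (SigSub (mem_set (dx : (~` diag_dom G) x))), false) end.
exists f => x y; rewrite /f; case: pselect => dx; case: pselect => dy //.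
- by move=> [].
- by move=> [] /ji[].
Qed.

Lemma card_eqTP T U (A : set U) : [set: T] #= A ->
  exists2 f : T -> U, injective f & forall y, A y <-> exists x, f x = y.
Proof.
move=> /card_bijP[f [g fK gK]].
pose t (x : T) : [set: T] := SigSub (mem_set (I : [set: T] x)).
have tK x : t (set_val x) = x by apply: val_inj.
exists (fun x => set_val (f (t x))).
  by move=> x y /val_inj/(can_inj fK)/(congr1 set_val).
move=> y; split=> [Ay|[x <-]]; last exact: set_valP.
by exists (set_val (g (SigSub (mem_set Ay)))); rewrite tK gK.
Qed.

(** * Subsets of full cardinality *)

(** The reverse inequality is automatic for a subset of [T], so this says that [A] has the
    cardinality of [T]. *)
Definition full T (A : set T) : Prop := [set: T] #<= A.

Lemma full_sub T (A B : set T) : A `<=` B -> full A -> full B.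
Proof. by move=> /subset_card_le AB TA; apply: card_le_trans TA AB. Qed.

Lemma full_range T (f : T -> T) (A : set T) :
  injective f -> (forall x, A (f x)) -> full A.
Proof. by move=> fi fA; apply/card_leTP; exists f. Qed.

Lemma full_preimage T (f : T -> T) (A : set T) :
  injective f -> full [set x | A (f x)] -> full A.
Proof.
move=> fi /card_leTP[g gi gA]; apply/card_leTP.
by exists (f \o g) => //; exact: inj_comp.
Qed.

Section FullSets.
Variable T : Type.
Hypothesis Tinf : infinite_set [set: T].
Implicit Types A B : set T.

(** Index the union by [T * T]. Either some row lies entirely in [A], or every row contains a point
    of [B]; choosing one such point per row injects [T] into [B]. *)
Lemma full_setU A B : full (A `|` B) -> full A \/ full B.
Proof.
move=> /card_leTP[g gi gAB].
have /card_leTTP[s si] := card_square Tinf.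
have [[x gA]|/forallNP nA] := pselect (exists x, forall y, A (g (s (x, y)))).
  by left; apply: full_range gA => y z /gi/si[].
have /choice[y By] : forall x, exists y, B (g (s (x, y))).
  move=> x; have /existsNP[y Ay] := nA x.
  by exists y; case: (gAB (s (x, y))).
by right; apply: full_range By => u v /gi/si[].
Qed.

Lemma full_square A : full A ->
  exists2 f : T * T -> T, injective f & forall p, A (f p).
Proof.
move=> /card_leTP[g gi gA]; have /card_leTTP[s si] := card_square Tinf.
by exists (g \o s) => [|p]; [exact: inj_comp|exact: gA].
Qed.

Lemma countable_embed (I : countType) : exists i : I -> T, injective i.
Proof.
have /infiniteP/card_leTTP[i ii] := Tinf.
by exists (i \o pickle); apply: inj_comp => //; exact: (pcan_inj pickleK).
Qed.

End FullSets.

(** * Construction and factorization of permutations *)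

Section Basics.
Variable T : Type.
Implicit Types f g : symg T.

Lemma symg_inj f : injective f.
Proof. exact: bij_inj (symg_bij f). Qed.

Lemma symg_mulE f g x : (f * g)%g x = f (g x).
Proof. by []. Qed.

Lemma symgK f : cancel f (f^-1)%g.
Proof. by move=> x; rewrite -symg_mulE mulVg. Qed.

Lemma symgVK f : cancel (f^-1)%g f.
Proof. by move=> x; rewrite -symg_mulE mulgV. Qed.

End Basics.
Arguments symg_inj {T} f.

Section Permutations.
Variable T : Type.
Implicit Types (f g h : symg T) (A : set T).

Lemma symg_of_surj (p : T -> T) :
  injective p -> (forall y, exists x, p x = y) -> exists q : symg T, q =1 p.
Proof.
move=> pi /choice[r pr].
have rp : cancel p r by move=> x; apply: pi.
by exists (Symg (Bijective rp pr)).
Qed.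

(** The complements of [A] and of its image are both equinumerous with [T], so a bijection between
    them completes [u]. *)
Lemma symg_glue A (u : T -> T) :
  (forall x y, A x -> A y -> u x = u y -> x = y) ->
  full (~` A) -> full (~` (u @` A)) ->
  exists p : symg T, forall x, A x -> p x = u x.
Proof.
move=> ui fA fB.
have cAB : [set: T] #= ~` A by rewrite card_eq_le fA card_leT.
have cB : [set: T] #= ~` (u @` A) by rewrite card_eq_le fB card_leT.
have [a ai aP] := card_eqTP cAB; have [b bi bP] := card_eqTP cB.
(* [c] inverts the enumeration [a] of the complement of [A]; its values on [A] are arbitrary. *)
have /choice[c cP] : forall x, exists t, ~ A x -> a t = x.
  move=> x; have [Ax|/aP[t <-]] := pselect (A x); last by exists t.
  by exists x.
pose p x := if pselect (A x) then u x else b (c x).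
have bN x y : A x -> u x <> b y.
  by move=> Ax E; have /bP : exists z, b z = b y by [exists y]; apply; exists x.
have pi : injective p.
  move=> x y; rewrite /p; case: pselect => Ax; case: pselect => Ay.
  - exact: ui.
  - by move=> /(bN _ _ Ax).
  - by move=> /esym/(bN _ _ Ay).
  - by move=> /bi E; rewrite -(cP _ Ax) -(cP _ Ay) E.
have ps y : exists x, p x = y.
  have [[x Ax <-]|/bP[t <-]] := pselect ((u @` A) y).
    by exists x; rewrite /p; case: pselect.
  have At : ~ A (a t) by apply/aP; exists t.
  exists (a t); rewrite /p; case: pselect => // Aat; congr b.
  exact/ai/cP.
have [q qp] := symg_of_surj pi ps.
by exists q => x Ax; rewrite qp /p; case: pselect.
Qed.

Lemma symg_extend X (i : X -> T) (q : symg X) : injective i ->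
  exists r : symg T, (forall x, r (i x) = i (q x)) /\
    forall y, ~ (exists x, y = i x) -> r y = y.
Proof.
move=> ii.
have /choice[p pP] : forall y, exists z,
    (forall x, y = i x -> z = i (q x)) /\ (~ (exists x, y = i x) -> z = y).
  move=> y; have [[x ->]|ny] := pselect (exists x, y = i x).
    by exists (i (q x)); split=> [x' /ii ->//|[]]; exists x.
  by exists y; split=> // x yx; case: ny; exists x.
have pi x : p (i x) = i (q x) by apply: (pP (i x)).1.
have pN y : ~ (exists x, y = i x) -> p y = y by apply: (pP y).2.
have [||r rp] := @symg_of_surj p; last by exists r; split=> *; rewrite rp; auto.
  move=> y z; have [[x ->]|ny] := pselect (exists x, y = i x).
    have [[x' ->]|nz] := pselect (exists x, z = i x).
      by rewrite !pi => /ii/(symg_inj q) ->.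
    by rewrite pi (pN _ nz) => E; case: nz; exists (q x).
  have [[x' ->]|nz] := pselect (exists x, z = i x).
    by rewrite pi (pN _ ny) => E; case: ny; exists (q x').
  by rewrite !pN.
move=> y; have [[x ->]|ny] := pselect (exists x, y = i x).
  by exists (i ((q^-1)%g x)); rewrite pi symgVK.
by exists y; rewrite pN.
Qed.

(** A permutation preserves its support, so if one of the two moves a point, the other fixes both
    that point and its image. *)
Lemma symg_disjoint_commute f g :
  (forall x, f x = x \/ g x = x) -> (f * g = g * f)%g.
Proof.
move=> fg; apply: symg_ext => x; rewrite !symg_mulE.
have [fx|gx] := fg x; rewrite ?fx ?gx.
  by have [//|/(symg_inj g) ->] := fg (g x); rewrite fx.
by have [/(symg_inj f) ->|->] := fg (f x).
Qed.

Hypothesis Tinf : infinite_set [set: T].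

(* For a maximal [A] disjoint from [f A], every point moved by [f] lies in
   [A], [f A] or the preimage of [A]. *)
Lemma full_disjoint_image f : full (nonfixed f) ->
  exists2 A, full A & forall x, A x -> ~ A (f x).
Proof.
move=> ff; pose P := [set A : set T | forall x, A x -> ~ A (f x)].
have [F FP Ftot|A [PA Amax]] := @Zorn_bigcup _ P.
  move=> x [X FX Xx] [Y FY Yfx].
  have [XY|YX] := Ftot _ _ FX FY.
  - exact: (FP _ FY) (XY _ Xx) Yfx.
  - exact: (FP _ FX) Xx (YX _ Yfx).
exists A => //.
have sub : nonfixed f `<=` A `|` [set x | A (f x)] `|` [set x | A ((f^-1)%g x)].
  move=> x fx; apply: contrapT => /not_orP[/not_orP[nx nfx] nVx].
  apply: (Amax (x |` A)).
    by split=> [y Ay|/(_ x (or_introl erefl))//]; right.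
  move=> y [->|Ay] [E|Afy].
  - exact: fx.
  - exact: nfx.
  - by apply: nVx => /=; rewrite -E symgK.
  - exact: PA Ay Afy.
have [|fA] := full_setU Tinf (full_sub sub ff).
  move=> /(full_setU Tinf)[//|].
  by apply: full_preimage; exact: symg_inj.
by apply: full_preimage fA; exact: symg_inj.
Qed.

(** Take three disjoint full sets and split the third into [W], inside the image under [g] of the
    first, and [V], outside it. If [W] is full, the second set works with it, as its image avoids
    that of the first; if [V] is full, the first set works. *)
Lemma full_translate_avoid g : exists Y D,
  [/\ full Y, full D, forall x, D x -> ~ Y x & forall x, Y x -> ~ D (g x)].
Proof.
have /card_leTTP[s si] := card_square Tinf.
have [t ti] := countable_embed Tinf 'I_3.
pose Y (j : 'I_3) := [set y | exists x, y = s (t j, x)].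
have Yf j : full (Y j).
  by apply: (@full_range _ (fun x => s (t j, x))) => [x y /si[]//|x]; exists x.
have Ydisj i j x : Y i x -> Y j x -> i = j.
  by move=> [u ->] [v /si[/ti]].
pose i0 : 'I_3 := inord 0; pose i1 : 'I_3 := inord 1; pose i2 : 'I_3 := inord 2.
have n01 : i0 <> i1 by move=> /(congr1 val); rewrite /= !inordK.
have n02 : i0 <> i2 by move=> /(congr1 val); rewrite /= !inordK.
have n12 : i1 <> i2 by move=> /(congr1 val); rewrite /= !inordK.
pose W := [set x | Y i2 x /\ Y i0 ((g^-1)%g x)].
pose V := [set x | Y i2 x /\ ~ Y i0 ((g^-1)%g x)].
have WV : Y i2 `<=` W `|` V.
  by move=> x Yx; have [|] := pselect (Y i0 ((g^-1)%g x)); [left|right].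
have [Wf|Vf] := full_setU Tinf (full_sub WV (Yf i2)).
  exists (Y i1), W; split=> // [x [x2 _] x1|x x1 [_]].
    by apply: n12; apply: Ydisj x1 x2.
  by rewrite symgK => x0; apply: n01; apply: Ydisj x0 x1.
exists (Y i0), V; split=> // [x [x2 _] x1|x x1 [_]].
  by apply: n02; apply: Ydisj x1 x2.
by rewrite symgK.
Qed.

(** Let [p] agree with [g] on [Y] and be the identity on a slice [D1] of [D]. Then [p] fixes [D1]
    and [p^-1 * g] fixes [Y]. A second slice of [D], outside both domain and image, provides the
    full complements that gluing requires. *)
Lemma full_fixed_factor g : exists p : symg T,
  full [set x | p x = x] /\ full [set x | (p^-1 * g)%g x = x].
Proof.
have [Y [D [Yf Df DY YD]]] := full_translate_avoid g.
have [d di dD] := full_square Tinf Df.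
have [t ti] := countable_embed Tinf bool.
have tn : t true <> t false by move=> /ti.
pose D1 := [set y | exists x, y = d (t true, x)].
have D1D x : D1 x -> D x by move=> [y ->].
pose u x := if pselect (Y x) then g x else x.
have uY x : Y x -> u x = g x by rewrite /u; case: pselect.
have uD x : D1 x -> u x = x.
  by move=> /D1D/DY; rewrite /u; case: pselect.
have D2f A : (forall x, ~ A (d (t false, x))) -> full (~` A).
  by apply: full_range => x y /di[].
have D2N x : ~ D1 (d (t false, x)) by move=> [y /di[/esym]].
have [|||p pu] := @symg_glue (Y `|` D1) u.
- move=> x y [Yx|Dx] [Yy|Dy].
  + by rewrite !uY // => /(symg_inj g).
  + by rewrite uY // uD // => E; have := YD _ Yx; rewrite E; case; apply: D1D.
  + by rewrite uD // uY // => E; have := YD _ Yy; rewrite -E; case; apply: D1D.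
  + by rewrite !uD.
- by apply: D2f => x [/DY|/D2N //]; apply.
- apply: D2f => x [y [Yy|Dy]].
  + by rewrite uY // => E; apply: YD Yy _; rewrite E.
  + by rewrite uD // => E; apply: (D2N x); rewrite -E.
exists p; split.
  apply: full_sub (_ : full D1); last first.
    by apply: (@full_range _ (fun x => d (t true, x))) => [x y /di[]//|x]; exists x.
  by move=> x Dx /=; rewrite pu ?uD //; right.
apply: full_sub Yf => x Yx; rewrite /mkset symg_mulE.
by apply: (symg_inj p); rewrite symgVK pu ?uY //; left.
Qed.

End Permutations.

(* The shift of the integers, [inl n] standing for n and [inr n] for -(n + 1). *)
Definition zshift (z : nat + nat) : nat + nat :=
  match z with inl n => inl n.+1 | inr 0 => inl 0 | inr n.+1 => inr n end.

Definition zunshift (z : nat + nat) : nat + nat :=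
  match z with inr n => inr n.+1 | inl 0 => inr 0 | inl n.+1 => inl n end.

Lemma zshiftK : cancel zshift zunshift.
Proof. by case=> [n|[|n]]. Qed.

Lemma zunshiftK : cancel zunshift zshift.
Proof. by case=> [[|n]|n]. Qed.

Lemma symg_prod X Y (p : symg X) (q : symg Y) :
  exists r : symg (X * Y), forall z, r z = (p z.1, q z.2).
Proof.
have c1 : cancel (fun z => (p z.1, q z.2)) (fun z => ((p^-1)%g z.1, (q^-1)%g z.2)).
  by move=> [x y] /=; rewrite !symgK.
have c2 : cancel (fun z => ((p^-1)%g z.1, (q^-1)%g z.2)) (fun z => (p z.1, q z.2)).
  by move=> [x y] /=; rewrite !symgVK.
by exists (Symg (Bijective c1 c2)).
Qed.

(** * Subgroups and normal closure *)

Section Subgroups.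
Variable G : groupType.
Implicit Types (H X : set G) (x y : G).

Lemma subgroupP H : subgroup H <->
  H 1%g /\ (forall x y, H x -> H y -> H (x * y^-1)%g).
Proof.
split=> [[/set_mem H1 HV]|[H1 HV]].
  by split=> // x y Hx Hy; apply/set_mem/HV; exact: mem_set.
by split=> [|x y /set_mem Hx /set_mem Hy]; apply: mem_set; auto.
Qed.

Lemma subgroupV H x : subgroup H -> H x -> H (x^-1)%g.
Proof. by move=> /subgroupP[H1 HV] Hx; rewrite -[(x^-1)%g]mul1g; apply: HV. Qed.

Lemma subgroupM H x y : subgroup H -> H x -> H y -> H (x * y)%g.
Proof.
move=> sH Hx Hy; rewrite -[y]invgK; case/subgroupP: (sH) => _; apply=> //.
exact: subgroupV.
Qed.

Lemma smallest_subgroup X : subgroup (smallest (@subgroup G) X).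
Proof.
apply/subgroupP; split=> [H [/subgroupP[]]//|x y Hx Hy H [sH XH]].
have /subgroupP[_ HV] := sH.
by apply: HV; [exact: Hx|exact: Hy].
Qed.

Lemma smallest_subgroup_normal X :
  (forall g x, X x -> X (g * x * g^-1)%g) ->
  forall g x, smallest (@subgroup G) X x ->
    smallest (@subgroup G) X (g * x * g^-1)%g.
Proof.
move=> Xn g x Hx H [sH XH].
have /subgroupP[H1 HV] := sH.
(* The preimage of [H] under conjugation by [g] is again a subgroup containing [X]. *)
apply: (Hx [set y | H (g * y * g^-1)%g]); split; last first.
  by move=> y Xy; apply/XH/Xn.
apply/subgroupP; split=> [|y z /= Hy Hz]; first by rewrite /mkset mulg1 mulgV.
suff -> : (g * (y * z^-1) * g^-1 = (g * y * g^-1) * (g * z * g^-1)^-1)%g.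
  exact: HV.
by rewrite !invgM invgK !mulgA mulgVK.
Qed.

End Subgroups.

(** * Normal subgroups containing an element of full support *)

Section Normal.
Variable T : Type.
Hypothesis Tinf : infinite_set [set: T].
Variable N : set (symg T).
Hypothesis sN : subgroup N.
Hypothesis nN : forall g x, N x -> N (g * x * g^-1)%g.

Lemma normal_commg g x : N x -> N (g * x * g^-1 * x^-1)%g.
Proof. by move=> Nx; apply: subgroupM; [|exact: nN|exact: subgroupV]. Qed.

Lemma normal_commg_l g x : N x -> N (x * g * x^-1 * g^-1)%g.
Proof.
by move=> Nx; rewrite -!mulgA; apply: subgroupM => //; rewrite mulgA;
  apply: nN; exact: subgroupV.
Qed.

(* If [h] and [s] are supported in [A] and [f A] is disjoint from [A], then [s]
   commutes with [f h^-1 f^-1], so that [[h, f], s] = [h, s]. *)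
Lemma normal_commg_disjoint (A : set T) (f h s : symg T) : N f ->
  (forall x, A x -> ~ A (f x)) ->
  (forall x, ~ A x -> h x = x) -> (forall x, ~ A x -> s x = x) ->
  N (h * s * h^-1 * s^-1)%g.
Proof.
move=> Nf Af hA sA.
pose k := (f * h^-1 * f^-1)%g.
have ks : (s * k = k * s)%g.
  apply: symg_disjoint_commute => x.
  have [Ax|/sA ->] := pselect (A x); last by left.
  right; rewrite /k !symg_mulE.
  have nA : ~ A ((f^-1)%g x) by move=> /Af; rewrite symgVK.
  by rewrite -{1}(hA _ nA) symgK symgVK.
have Nw : N (h * k)%g by rewrite /k !mulgA; exact: normal_commg.
have := normal_commg_l s Nw; congr N.
clearbody k.
by rewrite invgM !mulgA -(mulgA h k s) -ks !mulgA mulgK.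
Qed.

(* With slices [tau z] of [A] indexed by the integers, [h] acting as [k] on the
   nonnegative slices and [s] the shift, [[h, s]] acts as [k] on slice 0 only. *)
Lemma normal_slice f : N f -> full (nonfixed f) ->
  exists tau : bool * T -> T, injective tau /\
    forall k : symg T, exists K : symg T, [/\ N K,
      forall x, K (tau (true, x)) = tau (true, k x) &
      forall y, ~ (exists x, y = tau (true, x)) -> K y = y].
Proof.
move=> Nf ff; have [A fA Af] := full_disjoint_image Tinf ff.
have [a ai aA] := full_square Tinf fA.
have [i ii] := countable_embed Tinf (nat + nat)%type.
pose t (p : (nat + nat) * T) := a (i p.1, p.2).
have ti : injective t by move=> [z x] [w y] /ai /= [/ii -> ->].
(* The label [true] selects slice 0, where [K] acts; [false] selects slice -1, kept as spare room
   for later gluing. *)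
exists (fun p => t (if p.1 then inl 0 else inr 0, p.2)); split.
  by move=> [[] x] [[] y] /ti [] // ->.
move=> k.
have [sh shE] := symg_prod (Symg (Bijective zshiftK zunshiftK)) (symg_one T).
have [s [st sN']] := symg_extend sh ti.
have [kk kkE] := symg_prod (symg_one nat) k.
have [|h [ht hN]] := @symg_extend _ _ (fun p : nat * T => t (inl p.1, p.2)) kk.
  by move=> [m x] [n y] /ti /= [-> ->].
have [|K [Kt KN]] := @symg_extend _ _ (fun x : T => t (inl 0, x)) k.
  by move=> x y /ti [].
have hl n x : h (t (inl n, x)) = t (inl n, k x).
  by have := ht (n, x); rewrite kkE.
have hr n x : h (t (inr n, x)) = t (inr n, x).
  by apply: hN => -[[m y]] /ti.
have sE z x : s (t (z, x)) = t (zshift z, x) by have := st (z, x); rewrite shE.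
have tA p : A (t p) by exact: aA.
exists K; split=> //.
suff -> : K = (h * s * h^-1 * s^-1)%g.
  apply: (normal_commg_disjoint Nf Af) => x Ax.
    by apply: hN => -[p E]; apply: Ax; rewrite E.
  by apply: sN' => -[p E]; apply: Ax; rewrite E.
(* Checked slice by slice: [K] acts only on what [s] brings from slice -1 to slice 0, where [h] acts
   after the shift but not before it. *)
suff E : (h * s = K * s * h)%g by rewrite E !mulgK.
have Kn z x : z <> inl 0 -> K (t (z, x)) = t (z, x).
  by move=> z0; apply: KN => -[y /ti[]].
apply: symg_ext => y; rewrite !symg_mulE.
have [[[z x] ->]|ny] := pselect (exists p, y = t p).
  case: z => [n|[|n]]; rewrite ?hl ?hr !sE /= ?hl ?hr ?Kt //.
  - by rewrite Kn.
  - by rewrite Kn.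
have hy : h y = y by apply: hN => -[p E]; apply: ny; exists (inl p.1, p.2).
have sy : s y = y by apply: sN'.
rewrite hy sy hy KN // => -[x E]; apply: ny; by exists (inl 0, x).
Qed.

(** Some [s] carries the points moved by [k] into the slice [true]; the fixed points of [k] and the
    slice [false] leave room for it. Conjugation by [s] turns [k] into the element [K] of [N]. *)
Lemma normal_full_fixed (f k : symg T) : N f -> full (nonfixed f) ->
  full [set x | k x = x] -> N k.
Proof.
move=> Nf ff kf; have [t [ti tP]] := normal_slice Nf ff.
have [K [NK Kt KN]] := tP k.
pose A := [set x | k x <> x].
have [x y _ _ /ti[]//|||s sE] := @symg_glue _ A (fun x => t (true, x)).
- by apply: full_sub kf => x kx; apply.
- apply: (@full_range _ (fun x => t (false, x))) => [x y /ti[]//|x [y _ /ti]//].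
suff -> : k = (s^-1 * K * s^-1^-1)%g by exact: nN.
rewrite invgK -mulgA; apply: (mulgI s); rewrite mulVKg.
apply: symg_ext => x; rewrite !symg_mulE.
have [kx|kx] := pselect (k x = x); last first.
  by rewrite !sE ?Kt // => /(symg_inj k).
(* A fixed point of [k] may also land in the slice, at the place of some [z]. If [k] moved [z], then
   [s z = s x] would force [z = x]. *)
rewrite kx; have [[z E]|nz] := pselect (exists z, s x = t (true, z)); last first.
  by rewrite KN.
rewrite E Kt; have [->//|kz] := pselect (k z = z).
by move: E; rewrite -(sE _ kz) => /(symg_inj s) zx; case: kz; rewrite -zx.
Qed.

(* Baer-Schreier-Ulam *)
Lemma normal_full_support f : N f -> full (nonfixed f) -> N = [set: symg T].
Proof.
move=> Nf ff; rewrite -subTset => g _.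
have [p [fp fpg]] := full_fixed_factor Tinf g.
rewrite -[g](mulVKg p); apply: (subgroupM sN);
  exact: (normal_full_fixed Nf ff).
Qed.

End Normal.

(** * Supports of the generators *)

(** A finite set carries a cyclic shift; an infinite one is equinumerous with [T * bool], where the
    boolean can be flipped. *)
Lemma symg_fixfree T : `I_2 #<= [set: T] ->
  exists q : symg T, forall x, q x <> x.
Proof.
move=> T2.
suff [X [q qN /card_eqTP[i ii iP]]] : exists X : Type,
    exists2 q : symg X, (forall x, q x <> x) & [set: X] #= [set: T].
  have [r [ri _]] := symg_extend q ii.
  exists r => y; have /iP[x <-] : [set: T] y by [].
  by rewrite ri => /ii; exact: qN.
have [[n Tn]|Tinf] := pselect (finite_set [set: T]).
  exists 'I_n; have n2 : (2 <= n)%N.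
    by rewrite -card_le_II -(card_le_eqr Tn).
  exists (Symg (Bijective (@ordSK n) (@ord_predK n))).
    move=> [m mn] /(congr1 val) /=; move: mn; rewrite leq_eqVlt.
    case/orP=> [/eqP mn|mn]; last by rewrite modn_small // => /esym/n_Sn.
    by rewrite mn modnn => m0; rewrite -mn -m0 in n2.
  by rewrite card_eq_sym; apply: card_eq_trans Tn card_II.
exists (T * bool)%type.
have [q qE] := symg_prod (symg_one T) (Symg (Bijective negbK negbK)).
exists q; first by move=> [x []]; rewrite qE.
rewrite card_eq_le; apply/andP; split.
  apply: card_mul_bool_of_square; last exact: card_square.
  by have [i ii] := countable_embed Tinf bool; apply/card_leTTP; exists i.
by apply/card_leTTP; exists (fun x => (x, true)) => x y [].
Qed.

Lemma S_card_conj alpha beta T (g f : symg T) :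
  S_card alpha beta T f -> S_card alpha beta T (g * f * g^-1)%g.
Proof.
move=> [F [nF tF eF cF]]; exists (fun i => g @` F i); split.
- rewrite -image_bigcup -nF; apply/seteqP; split=> x.
    rewrite /nonfixed /mkset !symg_mulE => fx; exists ((g^-1)%g x).
      by move=> E; apply: fx; rewrite E symgVK.
    exact: symgVK.
  case=> y fy <-; rewrite /nonfixed /mkset !symg_mulE symgK => /(symg_inj g).
  exact: fy.
- move=> i j _ _ [_ [[x Fx <-] [y Fy /(symg_inj g) yx]]].
  by apply: tF => //; exists x; split=> //; rewrite -yx.
- by move=> i _ [x Fx <-]; rewrite !symg_mulE symgK; exists (f x) => //; exact: eF.
- move=> i; apply: card_eq_trans (cF i).
  by apply: inj_card_eq; apply: in2W; exact: symg_inj.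
Qed.

(** Transport to [T] the product of the identity on [alpha] with a fixed-point-free permutation of
    [beta]; the slices over [alpha] are the eigenspaces. *)
Lemma S_card_fixfree alpha beta T :
  `I_2 #<= [set: beta] -> [set: alpha * beta] #= [set: T] ->
  exists2 f : symg T, S_card alpha beta T f & nonfixed f = [set: T].
Proof.
move=> /symg_fixfree[q qN] /card_eqTP[e ei eP].
have [r rE] := symg_prod (symg_one alpha) q.
have [f [fe _]] := symg_extend r ei.
have fN : nonfixed f = [set: T].
  rewrite -subTset => y /eP[[i b] <-]; rewrite /nonfixed /mkset fe rE => /ei[] /=; exact: qN.
exists f => //; exists (fun i => range (fun b => e (i, b))); split.
- rewrite fN; apply/esym; rewrite -subTset => y /eP[[i b] <-].
  by exists i => //; exists b.
- by move=> i j _ _ [_ [[b _ <-] [c _ /ei[]]]].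
- by move=> i _ [b _ <-]; rewrite fe rE; exists (q b).
- by move=> i; apply: inj_card_eq => b c _ _ /ei[].
Qed.

(** [T] embeds in [alpha * beta], hence in the square of the larger factor. That factor is then
    infinite, so it equals its square and has at least the cardinality of [T]. *)
Lemma S_card_full_support alpha beta T (f : symg T) :
  infinite_set [set: T] -> S_card alpha beta T f -> full (nonfixed f) ->
  [set: alpha] #= [set: T] \/ [set: beta] #= [set: T].
Proof.
move=> Tinf [F [nF tF _ cF]] /card_leTP[t ti tf].
have /choice[p pP] : forall i, exists p : beta -> T,
    injective p /\ forall y, F i y <-> exists x, p x = y.
  move=> i; have /card_eqTP[p pi pF] : [set: beta] #= F i by rewrite card_eq_sym.
  by exists p.
have /choice[c cE] : forall x, exists z : alpha * beta, p z.1 z.2 = t x.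
  move=> x; have := tf x; rewrite nF => -[i _ /(pP i).2[b E]].
  by exists (i, b).
have ci : injective c by move=> x y cxy; apply: ti; rewrite -!cE cxy.
have [x _] := infinite_setN0 Tinf.
(* Both factors are nonempty: [b] selects one point in each eigenspace, which embeds [alpha], and
   the eigenspace at [a] is a copy of [beta]. *)
have [a b] := c x.
have aT : [set: alpha] #<= [set: T].
  apply/card_leTTP; exists (fun i => p i b) => i j E.
  apply: tF => //; exists (p i b); split; first by apply/(pP i).2; exists b.
  by rewrite E; apply/(pP j).2; exists b.
have bT : [set: beta] #<= [set: T].
  by apply/card_leTTP; exists (p a); exact: (pP a).1.
have key X : [set: T] #<= [set: X * X] -> [set: X] #<= [set: T] ->
    [set: X] #= [set: T].
  move=> TX XT; rewrite card_eq_le XT /=; apply: (card_le_trans TX).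
  apply: card_square => Xfin; apply: Tinf; apply: card_le_finite TX _.
  by rewrite -setXTT; exact: finite_setX.
have [/card_leTTP[j ji]|/card_leTTP[j ji]] := card_le_total alpha beta.
  right; apply: key => //; apply/card_leTTP.
  exists (fun x => (j (c x).1, (c x).2)) => u v E; apply: ci.
  exact: (injective_pair ji (g := id)) E.
left; apply: key => //; apply/card_leTTP.
exists (fun x => ((c x).1, j (c x).2)) => u v E; apply: ci.
exact: (injective_pair (f := id) _ ji) E.
Qed.

Lemma subgroup_small_support T : infinite_set [set: T] ->
  subgroup [set f : symg T | ~ full (nonfixed f)].
Proof.
move=> Tinf; apply/subgroupP; split=> [|f g ff gg].
  move=> /card_leTP[i _ iN]; have [x _] := infinite_setN0 Tinf.
  exact: (iN x).
move=> fg; have sub : nonfixed (f * g^-1)%g `<=` nonfixed f `|` nonfixed g.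
  move=> x; rewrite /nonfixed /mkset symg_mulE => fgx.
  have [gx|gx] := pselect (g x = x); [left|by right].
  by move: fgx; rewrite -{1}gx symgK.
by have [] := full_setU Tinf (full_sub sub fg).
Qed.

(** The two nondegeneracy hypotheses exclude cases where one cardinal is |Omega| but the other is
    too small or too large, so that the set of generators is empty or contains only the identity. *)
Theorem theorem7 (Omega alpha beta : Type)
  (Omega_infinite : infinite_set [set: Omega])
  (beta_nondegenerate : [set: alpha] #= [set: Omega] ->
     (`I_2 #<= [set: beta]) /\ ([set: beta] #<= [set: Omega]))
  (alpha_nondegenerate : [set: beta] #= [set: Omega] ->
     (`I_1 #<= [set: alpha]) /\ ([set: alpha] #<= [set: Omega])) :
  generating (S_card alpha beta Omega) <->
  ([set: alpha] #= [set: Omega]) \/ ([set: beta] #= [set: Omega]).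
Proof.
split=> [gen|ab].
  apply: contrapT => nab.
  have small : S_card alpha beta Omega `<=` [set f | ~ full (nonfixed f)].
    by move=> f Sf ff; apply: nab; exact: S_card_full_support Sf ff.
  (* A permutation moving every point lies outside the subgroup of small supports. *)
  have [q qN] : exists q : symg Omega, forall x, q x <> x.
    apply: symg_fixfree; apply: card_le_trans (card_leT _) _.
    exact/infiniteP.
  have : smallest (@subgroup (symg Omega)) (S_card alpha beta Omega) q.
    by rewrite gen.
  move=> /(smallest_sub (subgroup_small_support Omega_infinite) small); apply.
  exact: (@full_range _ id).
(* The cardinal equal to |Omega| absorbs the other, which is nonzero and at most |Omega|. *)
have [b2 cab] : `I_2 #<= [set: beta] /\ [set: alpha * beta] #= [set: Omega].
  have prod_le : [set: alpha] #<= [set: Omega] -> [set: beta] #<= [set: Omega] ->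
      [set: alpha * beta] #<= [set: Omega].
    move=> /card_leTTP[f fi] /card_leTTP[g gi].
    apply: card_le_trans (card_square Omega_infinite).
    by apply/card_leTTP; exists (fun p => (f p.1, g p.2)); exact: injective_pair.
  case: ab => [aO|bO].
    have [b2 bO] := beta_nondegenerate aO; split=> //.
    have /andP[aO1 aO2] : ([set: alpha] #<= [set: Omega]) &&
      ([set: Omega] #<= [set: alpha]) by rewrite -card_eq_le.
    rewrite card_eq_le prod_le //=; apply: (card_le_trans aO2).
    have /card_leP[i] := b2.
    pose b := set_val (i (SigSub (mem_set (isT : `I_2 0)))).
    by apply/card_leTTP; exists (fun x => (x, b)) => x y [].
  have [a1 aO] := alpha_nondegenerate bO.
  have /andP[bO1 bO2] : ([set: beta] #<= [set: Omega]) &&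
    ([set: Omega] #<= [set: beta]) by rewrite -card_eq_le.
  split.
    apply: card_le_trans bO2; apply: card_le_trans (card_leT _) _.
    exact/infiniteP.
  rewrite card_eq_le prod_le //=; apply: (card_le_trans bO2).
  have /card_leP[i] := a1.
  pose a := set_val (i (SigSub (mem_set (isT : `I_1 0)))).
  by apply/card_leTTP; exists (fun x => (a, x)) => x y [].
have [f Sf fN] := S_card_fixfree b2 cab.
apply: (normal_full_support Omega_infinite (smallest_subgroup _) _
  (f := f)).
- by apply: smallest_subgroup_normal => g x; exact: S_card_conj.
- exact: sub_gen_smallest.
- by rewrite fN /full.
Qed.
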